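(* For any real number $\gamma \geq 2$, there is a randomized algorithm for the minimum and sorting problems under uncertainty whose expected number of queries is at most $\min\{(1+\frac{1}{\gamma-1}+\xi)\cdot(1+\frac{k_M}{\mathrm{opt}}), \gamma\}\cdot\mathrm{opt}$ on every instance, for some $\xi \leq \frac{\gamma - \lfloor \gamma \rfloor}{(\gamma-1)^2} \leq 1$.
   Context: Each interval $I_i$ is open $(L_i,U_i)$ or trivial $\{w_i\}$, has an unknown true value $w_i\in I_i$ (revealed by a query) and a predicted value $\bar w_i\in I_i$. Minimum problem: given intervals $\mathcal{I}$ and a family $\mathcal{S}$ of subsets, determine for each $S\in\mathcal{S}$ an element of minimum true value. Sorting problem: determine for each $S\in\mathcal{S}$ the order of its elements by true value. A query set $Q$ is feasible if the answer is the same for all value assignments in the intervals agreeing with the true values on $Q$; $\mathrm{opt}$ is the minimum size of a feasible query set; the algorithm queries adaptively until its queries are feasible. An interval is mandatory if it is in every feasible query set, and prediction mandatory if it is in every feasible query set when the true values are assumed to equal the predictions; with $\mathcal{I}_R$, $\mathcal{I}_P$ these sets, $k_M=|\mathcal{I}_P\triangle\mathcal{I}_R|$. *)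

(* Defs.v *)
From HB Require Import structures.
From mathcomp Require Import all_boot all_order all_algebra.
From mathcomp Require Import all_classical all_reals all_analysis.

Set Implicit Arguments.
Unset Strict Implicit.
Unset Printing Implicit Defensive.

Import Order.TTheory GRing.Theory Num.Theory.

Local Open Scope ring_scope.

Inductive uncertainty_interval (R : Type) : Type :=
| OpenInterval of R & R
| TrivialInterval of R.

Definition itv_of (R : realType) (I : uncertainty_interval R) : interval R :=
  match I with
  | OpenInterval l u => `]l, u[
  | TrivialInterval v => `[v, v]
  end.

(* What an algorithm is given before its first query. *)
Record public_data (R : realType) (n : nat) : Type := PublicData {
  unc_itv : 'I_n -> uncertainty_interval R ;
  predicted : 'I_n -> R ;
  family : {set {set 'I_n}}
}.

Definition in_intervals (R : realType) (n : nat) (D : public_data R n)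
    (v : 'I_n -> R) : Prop :=
  forall i, v i \in itv_of (unc_itv D i).

(* The open intervals of an instance are nonempty because they contain the
   values [w i]. *)
Definition is_instance (R : realType) (n : nat) (D : public_data R n)
    (w : 'I_n -> R) : Prop :=
  in_intervals D w /\ in_intervals D (predicted D).

Definition agreeing (R : realType) (n : nat) (D : public_data R n)
    (w : 'I_n -> R) (Q : {set 'I_n}) (v : 'I_n -> R) : Prop :=
  in_intervals D v /\ {in Q, v =1 w}.

Inductive problem : Type := Minimum | Sorting.

Definition is_minimum (R : realType) (n : nat) (v : 'I_n -> R)
    (S : {set 'I_n}) (i : 'I_n) : Prop :=
  i \in S /\ (forall j, j \in S -> v i <= v j).

(* Elements of equal value may be listed in either order. *)
Definition is_ordering (R : realType) (n : nat) (v : 'I_n -> R)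
    (S : {set 'I_n}) (s : seq 'I_n) : Prop :=
  perm_eq s (enum S) /\ sorted (fun i j => v i <= v j) s.

(* One answer is correct for all the value assignments that agree with [w]
   on [Q].  The empty set has no minimum to determine. *)
Definition feasible (R : realType) (pb : problem) (n : nat)
    (D : public_data R n) (w : 'I_n -> R) (Q : {set 'I_n}) : Prop :=
  match pb with
  | Minimum => forall S, S \in family D -> S != finset.set0 ->
      exists i, forall v, agreeing D w Q v -> is_minimum v S i
  | Sorting => forall S, S \in family D ->
      exists s, forall v, agreeing D w Q v -> is_ordering v S s
  end.

(* The default value [n] is the size of the set of all intervals, which is
   feasible. *)
Definition opt (R : realType) (pb : problem) (n : nat)
    (D : public_data R n) (w : 'I_n -> R) : nat :=
  \big[minn/n]_(Q : {set 'I_n} | `[< feasible pb D w Q >]) #|Q|.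

Definition mandatory (R : realType) (pb : problem) (n : nat)
    (D : public_data R n) (w : 'I_n -> R) : {set 'I_n} :=
  [set i | `[< forall Q : {set 'I_n}, feasible pb D w Q -> i \in Q >]]%SET.

Definition k_M (R : realType) (pb : problem) (n : nat)
    (D : public_data R n) (w : 'I_n -> R) : nat :=
  let IP := mandatory pb D (predicted D) in
  let IR := mandatory pb D w in
  #|(IP :\: IR) :|: (IR :\: IP)|.

(* Deterministic adaptive query strategies, as decision trees that branch on
   the revealed value. *)
Inductive strategy (R : Type) (n : nat) : Type :=
| Stop
| Query of 'I_n & (R -> strategy R n).

Fixpoint queries (R : Type) (n : nat) (T : strategy R n) (w : 'I_n -> R)
    : seq 'I_n :=
  match T with
  | Stop => [::]
  | Query i next => i :: queries (next (w i)) w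
  end.

Record randomized_algorithm (R : realType) : Type := RandomizedAlgorithm {
  seed_display : measure_display ;
  seed : measurableType seed_display ;
  seed_law : probability seed R ;
  strategy_of : seed -> forall n : nat, public_data R n -> strategy R n ;
  measurable_queries : forall (n : nat) (D : public_data R n) (w : 'I_n -> R)
      (s : seq 'I_n),
    measurable ([set x | queries (strategy_of x D) w = s]%classic : set seed)
}.

Definition solves (R : realType) (pb : problem) (A : randomized_algorithm R)
    : Prop :=
  forall (x : seed A) (n : nat) (D : public_data R n) (w : 'I_n -> R),
    is_instance D w ->
    feasible pb D w [set i in queries (strategy_of x D) w]%SET.

Definition expected_queries (R : realType) (A : randomized_algorithm R)
    (n : nat) (D : public_data R n) (w : 'I_n -> R) : \bar R :=
  'E_(seed_law A)[fun x => (size (queries (strategy_of x D) w))%:R].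

(* Main.v *)
From HB Require Import structures.
From mathcomp Require Import all_boot all_order all_algebra.
From mathcomp Require Import all_classical all_reals all_analysis.
From mathcomp Require Import fintype finset zify ring lra.
Require Import Defs.

Set Implicit Arguments.
Unset Strict Implicit.
Unset Printing Implicit Defensive.

Import Order.TTheory GRing.Theory Num.Theory.

Local Open Scope ring_scope.

(** An interval [i] of a set [S] is mandatory as soon as its upper limit exceeds
    some value of [S \ i] while its lower limit is below all of them.  Hence the
    leftmost interval of an unsolved set is known to be mandatory if it contains
    another interval of the set, and otherwise forms a witness pair with every
    interval of the set that it overlaps.

    For an integer [gamma], query known mandatory intervals whenever there are
    some, and query predicted mandatory intervals in blocks: [gamma - 2] of them
    followed by a witness pair that contains one more.  A block costs [gamma],
    contains a query of every feasible set, and at least [gamma - 1] of its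
    elements are either mandatory or prediction errors.  Once no witness pair
    meets the predicted mandatory intervals, query a minimum vertex cover of the
    witness pairs.  Since no leftmost interval contains another one, every
    interval needed afterwards is mandatory and not predicted so: the cover is
    paid by [opt], the rest both by [opt] and by [k_M].

    Sorting a set amounts to finding the minima of its pairs.  A real [gamma] is
    reached by running the algorithm for [floor gamma] or [floor gamma + 1] at
    random, with mean [gamma]. *)

(** * Current bounds, certified minima, and criteria for mandatory intervals and witness pairs *)

Section CurrentBounds.
Variables (R : realType) (n : nat) (D : public_data R n).
Implicit Types (Q F S : {set 'I_n}) (v w : 'I_n -> R).

Definition lower i : R :=
  match unc_itv D i with OpenInterval l _ => l | TrivialInterval x => x end.

Definition upper i : R :=
  match unc_itv D i with OpenInterval _ u => u | TrivialInterval x => x end.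

Definition cur_lower Q v i : R := if i \in Q then v i else lower i.
Definition cur_upper Q v i : R := if i \in Q then v i else upper i.

Lemma agreeing_refl Q v : in_intervals D v -> agreeing D v Q v.
Proof. by split. Qed.

Lemma agreeing_sym Q v w :
  in_intervals D v -> agreeing D v Q w -> agreeing D w Q v.
Proof. by move=> Dv [Dw wv]; split=> // i iQ; rewrite wv. Qed.

Lemma agreeing_trans Q1 Q2 v1 v2 w : Q1 \subset Q2 ->
  agreeing D v1 Q1 v2 -> agreeing D v2 Q2 w -> agreeing D v1 Q1 w.
Proof.
move=> /subsetP sQ [_ e1] [Dw e2]; split=> // i iQ.
by rewrite e2 ?sQ // e1.
Qed.

Lemma cur_lowerE Q v w i : agreeing D v Q w -> cur_lower Q w i = cur_lower Q v i.
Proof. by move=> [_ wv]; rewrite /cur_lower; case: ifP => // /wv. Qed.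

Lemma cur_upperE Q v w i : agreeing D v Q w -> cur_upper Q w i = cur_upper Q v i.
Proof. by move=> [_ wv]; rewrite /cur_upper; case: ifP => // /wv. Qed.

Lemma value_in_bounds Q v i : in_intervals D v ->
  cur_lower Q v i < v i < cur_upper Q v i \/
  cur_lower Q v i = v i /\ cur_upper Q v i = v i.
Proof.
move=> /(_ i); rewrite /cur_lower /cur_upper /lower /upper.
case: ifP => _; first by right.
case: (unc_itv D i) => [l u|x] /=; rewrite in_itv /=; first by left.
by rewrite -eq_le => /eqP ->; right.
Qed.

Lemma ge_cur_lower Q v i : in_intervals D v -> cur_lower Q v i <= v i.
Proof. by move=> /(value_in_bounds Q i) [/andP[/ltW]|[->]]. Qed.

Lemma le_cur_upper Q v i : in_intervals D v -> v i <= cur_upper Q v i.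
Proof. by move=> /(value_in_bounds Q i) [/andP[_ /ltW]|[_ ->]]. Qed.

Lemma cur_lower_mono Q1 Q2 v i : Q1 \subset Q2 -> in_intervals D v ->
  cur_lower Q1 v i <= cur_lower Q2 v i.
Proof.
move=> /subsetP sQ Dv; rewrite {2}/cur_lower; case: ifP => [_|iQ].
  exact: ge_cur_lower.
by rewrite /cur_lower; case: ifP => // /sQ; rewrite iQ.
Qed.

Lemma cur_upper_mono Q1 Q2 v i : Q1 \subset Q2 -> in_intervals D v ->
  cur_upper Q2 v i <= cur_upper Q1 v i.
Proof.
move=> /subsetP sQ Dv; rewrite {1}/cur_upper; case: ifP => [_|iQ].
  exact: le_cur_upper.
by rewrite /cur_upper; case: ifP => // /sQ; rewrite iQ.
Qed.

Lemma value_above Q w i (c : R) : in_intervals D w -> c < cur_upper Q w i ->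
  exists x, [/\ c < x, x \in itv_of (unc_itv D i) & i \in Q -> x = w i].
Proof.
move=> Dw; have := Dw i; rewrite /cur_upper; case: ifP => iQ; first by exists (w i).
rewrite /upper; case: (unc_itv D i) => [l u|x] /=; rewrite !in_itv /=; last first.
  by move=> _ cx; exists x; rewrite in_itv /= lexx.
move=> /andP[lw wu] cu; have [cl|lc] := leP c l.
  by exists (w i); rewrite in_itv /= lw wu (le_lt_trans cl lw).
exists ((c + u) / 2%:R); rewrite in_itv /=.
split=> //; lra.
Qed.

Lemma value_below Q w i (c : R) : in_intervals D w -> cur_lower Q w i < c ->
  exists x, [/\ x < c, x \in itv_of (unc_itv D i) & i \in Q -> x = w i].
Proof.
move=> Dw; have := Dw i; rewrite /cur_lower; case: ifP => iQ; first by exists (w i).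
rewrite /lower; case: (unc_itv D i) => [l u|x] /=; rewrite !in_itv /=; last first.
  by move=> _ cx; exists x; rewrite in_itv /= lexx.
move=> /andP[lw wu] cu; have [uc|cu'] := leP u c.
  by exists (w i); rewrite in_itv /= lw wu (lt_le_trans wu uc).
exists ((l + c) / 2%:R); rewrite in_itv /=.
split=> //; lra.
Qed.

(** The certificate that the bounds alone can give. [feasible_MinimumP] shows it to be complete,
    which turns feasibility into a condition on current bounds. *)
Definition solved_by Q v S e : Prop :=
  e \in S /\ forall j, j \in S -> j != e -> cur_upper Q v e <= cur_lower Q v j.

Lemma solved_byE Q v w S e : agreeing D v Q w ->
  solved_by Q v S e -> solved_by Q w S e.
Proof.
move=> vw [eS h]; split=> // j jS je.
by rewrite (cur_lowerE _ vw) (cur_upperE _ vw) h.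
Qed.

Lemma solved_by_mono Q1 Q2 v S e : Q1 \subset Q2 -> in_intervals D v ->
  solved_by Q1 v S e -> solved_by Q2 v S e.
Proof.
move=> sQ Dv [eS h]; split=> // j jS je.
apply: (le_trans (cur_upper_mono e sQ Dv)).
by apply: (le_trans (h _ jS je)); exact: cur_lower_mono.
Qed.

(** If the answer [e] had an upper bound above the lower bound of some [j], raising [e] to some [x]
    and lowering [j] below [x] would respect all queried values and refute the answer. *)
Lemma feasible_MinimumP Q w : in_intervals D w ->
  feasible Minimum D w Q <->
  (forall S, S \in family D -> S != finset.set0 -> exists e, solved_by Q w S e).
Proof.
move=> Dw; split=> [fQ S SF S0|h S SF S0]; last first.
  have [e [eS he]] := h S SF S0; exists e => v wv; split=> // j jS.
  have Dv := wv.1.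
  have [->//|je] := eqVneq j e.
  apply: (le_trans (le_cur_upper Q e Dv)); rewrite (cur_upperE _ wv).
  by apply: (le_trans (he _ jS je)); rewrite -(cur_lowerE _ wv) ge_cur_lower.
have [e he] := fQ S SF S0; exists e; split; first exact: (he w (agreeing_refl Q Dw)).1.
move=> j jS je; rewrite leNgt; apply/negP => lt_je.
have [x [ltx xe xQ]] := value_above Dw lt_je.
have [y [lty yj yQ]] := value_below Dw ltx.
pose v k := if k == e then x else if k == j then y else w k.
have wv : agreeing D w Q v.
  split=> k; rewrite /v; case: eqVneq => [->//|_]; case: eqVneq => [->//|_] //.
have := (he v wv).2 j jS; rewrite /v eqxx eqxx (negbTE je).
by rewrite leNgt lty.
Qed.

Lemma feasible_agreeing Q v w : in_intervals D v -> agreeing D v Q w ->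
  feasible Minimum D v Q -> feasible Minimum D w Q.
Proof.
move=> Dv vw /(feasible_MinimumP _ Dv) h; apply/(feasible_MinimumP _ vw.1).
by move=> S SF S0; have [e he] := h S SF S0; exists e; exact: solved_byE he.
Qed.

Lemma feasibleT w : in_intervals D w -> feasible Minimum D w finset.setT.
Proof.
move=> Dw S SF /set0Pn [i iS].
case: (arg_minP w iS) => e eS he; exists e => v [_ vw].
by split=> // j jS; rewrite !vw ?inE // he.
Qed.

Lemma feasible_mono Q1 Q2 w : in_intervals D w -> Q1 \subset Q2 ->
  feasible Minimum D w Q1 -> feasible Minimum D w Q2.
Proof.
move=> Dw sQ f1 S SF S0; have [i hi] := f1 S SF S0; exists i => v wv.
by apply: hi; apply: agreeing_trans sQ (agreeing_refl _ Dw) wv.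
Qed.

(* The comparison of the upper bounds makes a trivial interval win the ties. *)
Definition leftmost Q v S i : Prop :=
  i \in S /\ forall j, j \in S -> cur_lower Q v i < cur_lower Q v j \/
    cur_lower Q v i = cur_lower Q v j /\ cur_upper Q v i <= cur_upper Q v j.

Lemma leftmost_exists Q v S : S != finset.set0 -> exists i, leftmost Q v S i.
Proof.
move=> /set0Pn [i0 i0S].
case: (arg_minP (cur_lower Q v) i0S) => i1 i1S h1.
pose T := [pred j | (j \in S) && (cur_lower Q v j == cur_lower Q v i1)].
have Ti1 : T i1 by apply/andP.
case: (arg_minP (cur_upper Q v) Ti1) => i /andP[iS /eqP li] h2.
exists i; split=> // j jS; rewrite li.
have := h1 j jS; rewrite /= le_eqVlt => /orP[/eqP e|]; last by left.
by right; split=> //; apply: h2; apply/andP; rewrite e eqxx.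
Qed.

(** A value exceeds its lower bound unless its bounds coincide. If they coincide for [k] at the
    lower bound of [i], the tie-break would make the bounds of [i] coincide too. *)
Lemma leftmost_lt_values Q v w S i k : agreeing D v Q w -> leftmost Q v S i ->
  cur_lower Q v i < cur_upper Q v i -> k \in S -> k != i ->
  cur_lower Q v i < w k.
Proof.
move=> vw [iS hi] ntr kS ki.
have := value_in_bounds Q k vw.1.
rewrite (cur_lowerE _ vw) (cur_upperE _ vw).
case: (hi k kS) => [lt|[e hu]] [/andP[lw wu]|[lw uw]].
- exact: lt_trans lt lw.
- by rewrite -lw.
- by rewrite e.
- by move: ntr; rewrite ltNge e lw -uw hu.
Qed.

(** A leftmost interval whose bounds coincide, or which overlaps no other interval of the set, would
    itself be a certified minimum. *)
Lemma unsolved_leftmost Q v S i : in_intervals D v -> leftmost Q v S i ->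
  ~ (exists e, solved_by Q v S e) ->
  [/\ i \notin Q, cur_lower Q v i < cur_upper Q v i &
    exists j, [/\ j \in S, j != i & cur_lower Q v j < cur_upper Q v i]].
Proof.
move=> Dv lmi uns; have [iS hi] := lmi.
have lt_i : cur_lower Q v i < cur_upper Q v i.
  have [/andP[]|[le ue]] := value_in_bounds Q i Dv; first exact: lt_trans.
  case: uns; exists i; split=> // j jS _; rewrite ue -le.
  by case: (hi j jS) => [/ltW|[->]].
split=> //.
  by apply: contraL lt_i => iQ; rewrite /cur_lower /cur_upper iQ ltxx.
apply: contrapT => no; apply: uns; exists i; split=> // j jS ji.
rewrite leNgt; apply/negP => lt; apply: no; by exists j.
Qed.

Lemma mandatory_sub F w i : feasible Minimum D w F ->
  i \in mandatory Minimum D w -> i \in F.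
Proof. by move=> fF; rewrite inE => /asboolP; apply. Qed.

(** Without a query of [i] no answer can be certified: [i] may exceed [w j], and any other element
    may exceed [i]. *)
Lemma mandatory_of_value w S i j : in_intervals D w -> S \in family D ->
  i \in S -> (forall k, k \in S -> k != i -> lower i < w k) ->
  j \in S -> j != i -> w j < upper i -> i \in mandatory Minimum D w.
Proof.
move=> Dw SF iS hl jS ji hj; rewrite inE; apply/asboolP => F fF.
apply: contraT => iF.
have S0 : S != finset.set0 by apply/set0Pn; exists i.
have [e [eS he]] := (feasible_MinimumP F Dw).1 fF S SF S0.
have [ei|ei] := eqVneq e i.
  have := he j jS; rewrite ei => /(_ ji); rewrite {1}/cur_upper (negbTE iF).
  by move=> /le_trans /(_ (ge_cur_lower F j Dw)); rewrite leNgt hj.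
have := he i iS; rewrite eq_sym => /(_ ei); rewrite /cur_lower (negbTE iF).
by move=> /(le_trans (le_cur_upper F e Dw)); rewrite leNgt hl.
Qed.

(** Quantifying over all [w] that agree with the queries made so far expresses what the algorithm
    knows. [F] need not contain [Q], so one optimal set can be charged throughout. *)
Definition witness_pair Q v i j : Prop :=
  [/\ i \notin Q, j \notin Q, i != j & forall w F, agreeing D v Q w ->
    feasible Minimum D w F -> (i \in F) || (j \in F)].

Lemma leftmost_witness_pair Q v S i j : in_intervals D v -> S \in family D ->
  leftmost Q v S i -> i \notin Q -> cur_lower Q v i < cur_upper Q v i ->
  j \in S -> j \notin Q -> j != i ->
  cur_lower Q v j < cur_upper Q v i -> witness_pair Q v i j.
Proof.
move=> Dv SF lmi iQ lti jS jQ ji ltj; split=> //; first by rewrite eq_sym.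
move=> w F vw fF; apply: contraT; rewrite negb_or => /andP[iF jF].
have Dw := vw.1; have iS := lmi.1.
have S0 : S != finset.set0 by apply/set0Pn; exists i.
have [e [eS he]] := (feasible_MinimumP F Dw).1 fF S SF S0.
have [ei|ei] := eqVneq e i.
  have := he j jS; rewrite ei => /(_ ji); move: ltj.
  rewrite /cur_upper /cur_lower (negbTE iF) (negbTE iQ) (negbTE jF) (negbTE jQ).
  by rewrite leNgt => ->.
have := he i iS; rewrite eq_sym => /(_ ei); rewrite /cur_lower (negbTE iF).
move=> /(le_trans (le_cur_upper F e Dw)); rewrite leNgt.
have := leftmost_lt_values vw lmi lti eS ei.
by rewrite {1}/cur_lower (negbTE iQ) => ->.
Qed.

Definition known_mandatory Q v i : Prop :=
  forall w, agreeing D v Q w -> i \in mandatory Minimum D w.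

(** Whatever the value of [j] turns out to be, it lies below the upper limit of [i], so
    [mandatory_of_value] applies before [j] is queried. *)
Lemma leftmost_nested_mandatory Q v S i j : S \in family D ->
  leftmost Q v S i -> i \notin Q -> cur_lower Q v i < cur_upper Q v i ->
  j \in S -> j != i ->
  cur_lower Q v j < cur_upper Q v i -> cur_upper Q v j <= cur_upper Q v i ->
  known_mandatory Q v i.
Proof.
move=> SF lmi iQ lti jS ji ltj leu w vw.
apply: (mandatory_of_value vw.1 SF lmi.1 _ jS ji).
  move=> k kS ki; have := leftmost_lt_values vw lmi lti kS ki.
  by rewrite {1}/cur_lower (negbTE iQ).
have <- : cur_upper Q v i = upper i by rewrite /cur_upper (negbTE iQ).
have := value_in_bounds Q j vw.1; rewrite (cur_lowerE _ vw) (cur_upperE _ vw).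
by move=> [/andP[_ lt]|[<- _]] //; exact: lt_le_trans leu.
Qed.

End CurrentBounds.

(** * Strategies built one query at a time *)

Lemma card_setD_split (T : finType) (A Q : {set T}) (u : T) : u \notin Q ->
  #|A :\: Q| = ((u \in A) + #|A :\: (u |: Q)|)%N.
Proof.
move=> uQ; rewrite (cardsD1 u (A :\: Q)) !inE uQ /=; congr (_ + #|pred_of_set _|)%N.
by apply/setP => x; rewrite !inE negb_or andbA.
Qed.

Section Strategies.
Variables (R : realType) (n : nat) (D : public_data R n).
Implicit Types (Q F S C P : {set 'I_n}) (v w : 'I_n -> R) (s : seq 'I_n).

(** One representative assignment per answer suffices, since agreement on [i |: Q] depends only on
    the values there. An answer that no assignment realises leads to [Stop]. *)
Lemma query_step Q v i (Post : ('I_n -> R) -> seq 'I_n -> Prop) :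
  (forall v', agreeing D v Q v' -> exists T : strategy R n,
    forall w, agreeing D v' (i |: Q) w -> Post w (queries T w)) ->
  exists T : strategy R n, forall w, agreeing D v Q w ->
    exists2 s, queries T w = i :: s & Post w s.
Proof.
move=> h.
have /choice [next hnext] (x : R) : exists T : strategy R n,
    forall w, agreeing D v Q w -> w i = x -> Post w (queries T w).
  have [[v' [vv' v'x]]|no] := pselect (exists v', agreeing D v Q v' /\ v' i = x).
    have [T hT] := h v' vv'; exists T => w vw wx; apply: hT.
    split=> [|j]; first exact: vw.1.
    rewrite !inE => /orP[/eqP ->|jQ]; first by rewrite wx.
    by rewrite vw.2 // vv'.2.
  by exists (Stop R n) => w vw wx; case: no; exists w.
by exists (Query i next) => w vw; exists (queries (next (w i)) w) => //; exact: hnext.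
Qed.

Lemma query_seq Q v c (Post : ('I_n -> R) -> seq 'I_n -> Prop) :
  (forall v', agreeing D v Q v' -> exists T : strategy R n,
    forall w, agreeing D v' ([set x in c] :|: Q) w -> Post w (queries T w)) ->
  in_intervals D v ->
  exists T : strategy R n, forall w, agreeing D v Q w ->
    exists2 s, queries T w = c ++ s & Post w s.
Proof.
elim: c Q v => [|i c IH] Q v h Dv.
  have [T hT] := h v (agreeing_refl Q Dv).
  exists T => w vw; exists (queries T w) => //; apply: hT.
  by split=> [|j]; rewrite ?inE /=; [exact: vw.1|exact: vw.2].
have [] := @query_step Q v i (fun w s => exists2 s', s = c ++ s' & Post w s').
  move=> v' vv'; have [] := IH (i |: Q) v'; last first.
  - by move=> T hT; exists T.
  - exact: vv'.1.
  move=> v2 v'v2; have [|T hT] := h v2.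
    by apply: agreeing_trans v'v2; [exact: finset.subsetUr|].
  exists T => w v2w; apply: hT.
  suff <- : [set x in c] :|: (i |: Q) = [set x in i :: c] :|: Q by [].
  by apply/setP => x; rewrite !inE orbCA orbA.
move=> T hT; exists T => w vw; have [s -> [s' -> ps']] := hT w vw; by exists s'.
Qed.

(** Distinct queries outside [Q] let the length of [s] be compared with cardinals of sets without
    [Q]. *)
Definition completes Q w s : Prop :=
  [/\ uniq s, forall i, i \in s -> i \notin Q &
      feasible Minimum D w (Q :|: [set i in s])].

Lemma completes_nil Q w : feasible Minimum D w Q -> completes Q w [::].
Proof.
by move=> fQ; split=> //; suff -> : Q :|: [set i in [::]] = Q by [];
  apply/setP => x; rewrite !inE orbF.
Qed.

Lemma completes_cat Q w c s : uniq c -> (forall i, i \in c -> i \notin Q) ->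
  completes ([set x in c] :|: Q) w s -> completes Q w (c ++ s).
Proof.
move=> uc cQ [us sQ fQ]; split.
- rewrite cat_uniq uc us andbT; apply/hasPn => i /sQ.
  by rewrite !inE negb_or => /andP[].
- by move=> i; rewrite mem_cat => /orP[/cQ //|/sQ]; rewrite !inE negb_or => /andP[].
- suff <- : [set x in c] :|: Q :|: [set x in s] = Q :|: [set x in c ++ s] by [].
  by apply/setP => x; rewrite !inE mem_cat orbA (orbC (x \in Q)).
Qed.

Lemma completes_cons Q w i s : i \notin Q ->
  completes (i |: Q) w s -> completes Q w (i :: s).
Proof.
move=> iQ h; apply: (@completes_cat Q w [:: i]) => //.
  by move=> j; rewrite inE => /eqP ->.
suff -> : [set x in [:: i]] = [set i] by [].
by apply/setP => x; rewrite !inE.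
Qed.

Lemma infeasible_unsolved Q v : in_intervals D v ->
  ~ feasible Minimum D v Q ->
  exists S, [/\ S \in family D, S != finset.set0 &
    ~ exists e, solved_by D Q v S e].
Proof.
move=> Dv unf; apply: contrapT => no; apply: unf; apply/feasible_MinimumP => //.
by move=> S SF S0; apply: contrapT => uns; apply: no; exists S.
Qed.

Lemma witness_pair_sym Q v i j :
  witness_pair D Q v i j -> witness_pair D Q v j i.
Proof.
move=> [iQ jQ ij h]; split=> //; first by rewrite eq_sym.
by move=> w F vw fF; rewrite orbC; exact: h fF.
Qed.

(** * Queries that remain after a vertex cover of the witness pairs *)

Section AfterCover.
Variables (Q0 C : {set 'I_n}) (v0 : 'I_n -> R).
Hypothesis Dv0 : in_intervals D v0.
Hypothesis no_known : forall i, i \notin Q0 -> ~ known_mandatory D Q0 v0 i.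
Hypothesis C_cover : forall i j, witness_pair D Q0 v0 i j ->
  (i \in C) || (j \in C).

(* No leftmost interval contains another one of its set, since it would be a
   known mandatory interval.  So a queried leftmost interval has its value in
   every interval of the set that starts before that value. *)
Lemma unsolved_after_cover Q v : agreeing D v0 Q0 v -> C :|: Q0 \subset Q ->
  ~ feasible Minimum D v Q ->
  exists i, [/\ i \notin Q, known_mandatory D Q v i &
    exists j, witness_pair D Q0 v0 i j].
Proof.
move=> v0v sub unf; have Dv := v0v.1.
have [sCQ sQ0] : C \subset Q /\ Q0 \subset Q.
  by move: sub; rewrite finset.subUset => /andP[].
have [S [SF S0 uns]] := infeasible_unsolved Dv unf.
have uns0 : ~ exists e, solved_by D Q0 v0 S e.
  move=> [e he]; apply: uns; exists e; apply: solved_by_mono sQ0 Dv _.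
  exact: solved_byE v0v he.
have [i lmi] := leftmost_exists D Q0 v0 S0; have iS := lmi.1.
have [iQ0 lti [j0 [j0S j0i lt0]]] := unsolved_leftmost Dv0 lmi uns0.
have overlap j : j \in S -> j != i ->
    cur_lower D Q0 v0 j < cur_upper D Q0 v0 i ->
    witness_pair D Q0 v0 i j /\ cur_upper D Q0 v0 i < cur_upper D Q0 v0 j.
  move=> jS ji ltj.
  have lt_up : cur_upper D Q0 v0 i < cur_upper D Q0 v0 j.
    rewrite ltNge; apply/negP => leu; apply: (no_known iQ0).
    exact: (leftmost_nested_mandatory SF lmi iQ0 lti jS ji ltj leu).
  split=> //; apply: (leftmost_witness_pair Dv0 SF lmi iQ0 lti jS _ ji ltj).
  apply/negP => jQ0; have := lt_trans ltj lt_up.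
  by rewrite /cur_lower /cur_upper jQ0 ltxx.
(* If [i] is unqueried, an interval [j] still overlapping it must be queried, as otherwise their
   witness pair would be uncovered. The value of [j] then makes [i] mandatory. *)
have [iQ|iQ] := boolP (i \in Q); last first.
  have Ui : cur_upper D Q v i = upper D i by rewrite /cur_upper (negbTE iQ).
  have Ui0 : cur_upper D Q0 v0 i = upper D i by rewrite /cur_upper (negbTE iQ0).
  exists i; split=> //; last by exists j0; exact: (overlap _ j0S j0i lt0).1.
  have [j [jS ji ltj]] : exists j,
      [/\ j \in S, j != i & cur_lower D Q v j < cur_upper D Q v i].
    apply: contrapT => no; apply: uns; exists i; split=> // j jS ji.
    by rewrite leNgt; apply/negP => lt; apply: no; exists j.
  have jQ : j \in Q.
    apply: contraT => jQ.
    have jQ0 : j \notin Q0 by apply: contra jQ; exact: (subsetP sQ0).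
    have [|/C_cover] := overlap j jS ji.
      by move: ltj; rewrite Ui Ui0 /cur_lower (negbTE jQ) (negbTE jQ0).
    move=> /orP[/(subsetP sCQ)|/(subsetP sCQ)]; first by rewrite (negbTE iQ).
    by rewrite (negbTE jQ).
  move=> w vw; have v0w := agreeing_trans sQ0 v0v vw.
  apply: (mandatory_of_value vw.1 SF iS _ jS ji).
    move=> k kS ki; have := leftmost_lt_values v0w lmi lti kS ki.
    by rewrite {1}/cur_lower (negbTE iQ0).
  by rewrite -Ui vw.2 //; move: ltj; rewrite /cur_lower jQ.
(* If [i] is queried, its value lies below its former upper limit, hence below that of the new
   leftmost [i'], which is therefore mandatory. *)
have [i' lmi'] := leftmost_exists D Q v S0; have i'S := lmi'.1.
have [i'Q lti' _] := unsolved_leftmost Dv lmi' uns.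
have i'i : i' != i by apply: contraNneq i'Q => ->.
have i'Q0 : i' \notin Q0 by apply: contra i'Q; exact: (subsetP sQ0).
have Ui0 : cur_upper D Q0 v0 i = upper D i by rewrite /cur_upper (negbTE iQ0).
have v_i : v i < upper D i.
  have := value_in_bounds Q0 i Dv; rewrite (cur_lowerE _ v0v) (cur_upperE _ v0v) Ui0.
  move=> [/andP[]//|[el eu]]; by move: lti; rewrite Ui0 el eu ltxx.
have [|wp lt_up] := overlap i' i'S i'i.
  have le : cur_lower D Q v i' <= v i.
    have -> : v i = cur_lower D Q v i by rewrite /cur_lower iQ.
    by case: (lmi'.2 i iS) => [/ltW|[->]].
  rewrite Ui0; apply: le_lt_trans v_i; move: le.
  by rewrite /cur_lower (negbTE i'Q) (negbTE i'Q0).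
exists i'; split=> //; last by exists i; exact: witness_pair_sym.
move=> w vw; apply: (mandatory_of_value vw.1 SF i'S _ iS).
- move=> k kS ki; have := leftmost_lt_values vw lmi' lti' kS ki.
  by rewrite {1}/cur_lower (negbTE i'Q).
- by rewrite eq_sym.
- rewrite vw.2 //; apply: (lt_trans v_i); move: lt_up; rewrite Ui0.
  by rewrite /cur_upper (negbTE i'Q0).
Qed.

(** Iterates [unsolved_after_cover]. The witness pair at [Q0] is recorded for every query because it
    later excludes predicted mandatory intervals. *)
Lemma mandatory_phase Q v : agreeing D v0 Q0 v -> C :|: Q0 \subset Q ->
  exists T : strategy R n, forall w, agreeing D v Q w ->
    completes Q w (queries T w) /\
    forall i, i \in queries T w -> i \in mandatory Minimum D w /\
      exists j, witness_pair D Q0 v0 i j.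
Proof.
have [k] := ubnP #|~: Q|; elim: k Q v => // k IH Q v ltk v0v sub.
have Dv := v0v.1.
have [fQ|nfQ] := pselect (feasible Minimum D v Q).
  exists (Stop R n) => w vw; split=> //; apply: completes_nil.
  exact: feasible_agreeing fQ.
have [i [iQ mi [j wp]]] := unsolved_after_cover v0v sub nfQ.
have sub' : C :|: Q0 \subset i |: Q.
  exact: fintype.subset_trans sub (finset.subsetUr _ _).
have [] := @query_step Q v i (fun w s => completes (i |: Q) w s /\
    forall i, i \in s -> i \in mandatory Minimum D w /\
      exists j, witness_pair D Q0 v0 i j).
  move=> v' vv'; apply: (IH (i |: Q) v') => //.
    rewrite -ltnS; apply: leq_trans ltk; rewrite ltnS; apply: proper_card.
    apply/properP; split; first by rewrite finset.setCS finset.subsetUr.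
    by exists i; rewrite !inE ?eqxx.
  apply: agreeing_trans v0v vv'.
  by move: sub; rewrite finset.subUset => /andP[].
move=> T hT; exists T => w vw; have [s -> [cs hs]] := hT w vw; split.
  exact: completes_cons.
by move=> x; rewrite inE => /orP[/eqP ->|/hs //]; split; [exact: mi|exists j].
Qed.

End AfterCover.

(** * The covering phase and the blocks of predicted mandatory queries *)

Definition prediction_error P w : {set 'I_n} :=
  (P :\: mandatory Minimum D w) :|: (mandatory Minimum D w :\: P).

(** [c] counts the cover and [m] the later queries. [F :\: Q] is itself a cover, so minimality
    bounds [c]. The later queries are mandatory, hence in [F], and belong to witness pairs, hence
    lie outside [P] and are prediction errors. *)
Lemma cover_phase P Q v : in_intervals D v ->
  (forall i, i \notin Q -> ~ known_mandatory D Q v i) ->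
  (forall i j, witness_pair D Q v i j -> i \notin P) ->
  exists T : strategy R n, forall w, agreeing D v Q w ->
    completes Q w (queries T w) /\
    forall F, feasible Minimum D w F ->
      exists c m : nat, [/\ size (queries T w) = (c + m)%N,
        (c <= #|F :\: Q|)%N, (m <= #|F :\: Q|)%N &
        (m <= #|prediction_error P w :\: Q|)%N].
Proof.
move=> Dv no_known noP.
pose cover (C : {set 'I_n}) := [disjoint C & Q] &&
  `[< forall i j, witness_pair D Q v i j -> (i \in C) || (j \in C) >].
have coverT : cover (~: Q).
  apply/andP; split; first by rewrite disjoints_subset.
  by apply/asboolP => i j [iQ _ _ _]; rewrite !inE iQ.
case: (arg_minnP (fun C : {set 'I_n} => #|C|) coverT) => C /andP[dCQ /asboolP cC] minC.
have CQ i : i \in C -> i \notin Q by move=> iC; rewrite (disjointFr dCQ iC).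
have [||T hT] := @query_seq Q v (enum C) (fun w s =>
    completes (C :|: Q) w s /\
    forall i, i \in s -> i \in mandatory Minimum D w /\
      exists j, witness_pair D Q v i j) => //.
  move=> v' vv'; have eC : [set x in enum C] = C.
    by apply/setP => x; rewrite !inE mem_enum.
  by rewrite eC; exact: (mandatory_phase Dv no_known cC vv' (fintype.subxx _)).
exists T => w vw; have [s -> [cs hs]] := hT w vw.
have [us sQ _] := cs.
split.
  apply: completes_cat; first exact: enum_uniq.
    by move=> i; rewrite mem_enum; exact: CQ.
  suff -> : [set x in enum C] = C by [].
  by apply/setP => x; rewrite !inE mem_enum.
move=> F fF; exists #|C|, (size s); split.
- by rewrite size_cat -cardE.
- apply: minC; apply/andP; split.
    by rewrite disjoints_subset; apply/subsetP => x; rewrite !inE => /andP[].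
  apply/asboolP => i j [iQ jQ ij h]; rewrite !inE iQ jQ /=; exact: h fF.
- rewrite -(card_uniqP us); apply: subset_leq_card; apply/subsetP => i si.
  have := sQ i si; rewrite !inE negb_or => /andP[_ ->] /=.
  exact: mandatory_sub fF (hs i si).1.
- rewrite -(card_uniqP us); apply: subset_leq_card; apply/subsetP => i si.
  have := sQ i si; rewrite in_setD !in_setU negb_or => /andP[_ ->] /=.
  have [mi [j wp]] := hs i si.
  by rewrite !in_setD mi (noP _ _ wp) orbT.
Qed.

(* With [g = gamma - 2], [a] counts the queries of predicted mandatory
   intervals in the current block of [gamma] queries; a block is completed by a
   witness pair containing one more predicted mandatory interval. *)
Definition block_spec P (g a : nat) Q w s : Prop :=
  completes Q w s /\
  forall F, feasible Minimum D w F ->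
    [/\ #|F :\: Q| = 0%N -> size s = 0%N,
      (0 < #|F :\: Q| -> size s + a <= g.+2 * #|F :\: Q|)%N &
      (g.+1 * size s <=
        g.+2 * (#|F :\: Q| + #|prediction_error P w :\: Q|) + a)%N].

(** Amortized induction on the number of unqueried intervals. In the second bound of [block_spec]
    the [a] earlier queries wait for the witness pair that pays for them. In the third, each of them
    costs [g.+1], earns [g.+2] and leaves a surplus of one. An empty [F :\: Q] is treated apart
    because nothing there could pay for [a]. *)
Lemma block_phase P (g a : nat) Q v : (a <= g)%N -> in_intervals D v ->
  exists T : strategy R n, forall w, agreeing D v Q w ->
    block_spec P g a Q w (queries T w).
Proof.
have [k] := ubnP #|~: Q|; elim: k Q v a => // k IH Q v a ltk ag Dv.
have IH1 i : i \notin Q -> (#|~: (i |: Q)| < k)%N.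
  move=> iQ; rewrite -ltnS; apply: leq_trans ltk; rewrite ltnS; apply: proper_card.
  apply/properP; split; first by rewrite finset.setCS finset.subsetUr.
  by exists i; rewrite !inE ?eqxx.
have [fQ|nfQ] := pselect (feasible Minimum D v Q).
  exists (Stop R n) => w vw; split=> [|F fF] /=.
    exact/completes_nil/(feasible_agreeing Dv).
  by split=> //; nia.
have nfw w : agreeing D v Q w -> ~ feasible Minimum D w Q.
  move=> vw fQ; apply: nfQ.
  exact: feasible_agreeing vw.1 (agreeing_sym Dv vw) fQ.
have Fpos w F : agreeing D v Q w -> feasible Minimum D w F -> (0 < #|F :\: Q|)%N.
  move=> vw fF; rewrite lt0n cards_eq0 finset.setD_eq0; apply/negP => sFQ.
  by apply: (nfw w vw); exact: feasible_mono vw.1 sFQ fF.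
(* A known mandatory interval belongs to [F] and pays for itself, so the current block is
   unchanged. *)
have [[u [uQ mu]]|no_known] :=
    pselect (exists u, u \notin Q /\ known_mandatory D Q v u).
  have [|T hT] := query_step (Q := Q) (v := v) (i := u)
      (Post := block_spec P g a (u |: Q)).
    move=> v' vv'; exact: (IH (u |: Q) v' a (IH1 u uQ) ag vv'.1).
  exists T => w vw; have [s -> [cs hs]] := hT w vw.
  split; first exact: completes_cons.
  move=> F fF; have [h0 h1 h2] := hs F fF.
  have := mandatory_sub fF (mu w vw); have := card_setD_split F uQ.
  have := card_setD_split (prediction_error P w) uQ.
  move: h0 h1 h2 => /=; case: (u \in F) => //.
  move: #|F :\: (u |: Q)| #|prediction_error P w :\: (u |: Q)|.
  move: #|F :\: Q| #|prediction_error P w :\: Q| => f e f' e'.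
  move: (u \in prediction_error P w) => b h0 h1 h2 -> -> _; split=> // [_|].
    by case: f' h0 h1 {h2} => [/(_ erefl) -> _|f' _ /(_ isT)]; nia.
  by case: b; nia.
have no_known' i : i \notin Q -> ~ known_mandatory D Q v i.
  by move=> iQ mi; apply: no_known; exists i.
(* While the block has room, a predicted mandatory [u] is queried; it lies in [F] or is a prediction
   error. *)
have [[lag [u uPQ]]|noblock] :=
    pselect ((a < g)%N /\ exists u, u \in P :\: Q).
  have [uQ uP] : u \notin Q /\ u \in P by move: uPQ; rewrite inE => /andP.
  have [|T hT] := query_step (Q := Q) (v := v) (i := u)
      (Post := block_spec P g a.+1 (u |: Q)).
    move=> v' vv'; exact: (IH (u |: Q) v' a.+1 (IH1 u uQ) lag vv'.1).
  exists T => w vw; have [s -> [cs hs]] := hT w vw.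
  split; first exact: completes_cons.
  move=> F fF; have [h0 h1 h2] := hs F fF.
  have uFE : (u \in F) || (u \in prediction_error P w).
    have [mu|mu] := boolP (u \in mandatory Minimum D w).
      by rewrite (mandatory_sub fF mu).
    by rewrite in_setU in_setD mu uP orbT.
  have := Fpos w F vw fF.
  have := card_setD_split F uQ; have := card_setD_split (prediction_error P w) uQ.
  move: h0 h1 h2 uFE => /=.
  move: #|F :\: (u |: Q)| #|prediction_error P w :\: (u |: Q)|.
  move: #|F :\: Q| #|prediction_error P w :\: Q| => f e f' e'.
  move: (u \in F) (u \in prediction_error P w) => bF bE.
  move=> h0 h1 h2 bFE -> -> fpos; split=> //.
  - by move=> z; move: fpos; rewrite z.
  - move=> _.
    by case: f' h0 h1 fpos {h2} => [/(_ erefl) -> _|f' _ /(_ isT)];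
      case: bF {bFE} => /=; nia.
  - by case: bF bE bFE {fpos} => [] [] //= _; nia.
(* The pair closes the block: its cost [2 * g.+1] is met by [g.+2] from a member in [F] and the
   surplus [g]. *)
have [[u [x [uP wp]]]|noP] :=
    pselect (exists u x, u \in P /\ witness_pair D Q v u x).
  have [uQ xQ ux wF] := wp.
  (* As [u] is predicted mandatory and unqueried, room in the block would have led to the previous
     case. *)
  have ag' : a = g.
    apply/eqP; rewrite eqn_leq ag /= leqNgt; apply/negP => lag.
    by apply: noblock; split=> //; exists u; rewrite inE uQ.
  have xQ' : x \notin u |: Q by rewrite !inE negb_or eq_sym ux.
  have lt2 : (#|~: (x |: (u |: Q))| < k)%N.
    apply: leq_trans (IH1 u uQ); rewrite ltnS; apply: subset_leq_card.
    by rewrite finset.setCS finset.subsetUr.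
  have [|T hT] := query_step (Q := Q) (v := v) (i := u)
      (Post := fun w s => exists2 s', s = x :: s' &
        block_spec P g 0 (x |: (u |: Q)) w s').
    move=> v' vv'; apply: (query_step (v := v')) => v2 vv2.
    exact: (IH (x |: (u |: Q)) v2 0 lt2 (leq0n g) vv2.1).
  exists T => w vw; have [s -> [s' -> [cs hs]]] := hT w vw.
  split; first by apply: completes_cons => //; exact: completes_cons.
  move=> F fF; have [h0 h1 h2] := hs F fF.
  have := wF w F vw fF.
  have := card_setD_split F uQ; have := card_setD_split (prediction_error P w) uQ.
  have := card_setD_split F xQ'; have := card_setD_split (prediction_error P w) xQ'.
  move: h0 h1 h2 => /=; rewrite ag'.
  move: #|F :\: (x |: (u |: Q))| #|prediction_error P w :\: (x |: (u |: Q))| => f' e'.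
  move: (u \in F) (x \in F) (u \in prediction_error P w) (x \in prediction_error P w).
  move=> uF xF uE xE.
  move=> h0 h1 h2 -> -> -> -> b; split.
  - by case: uF b => //=; case: xF.
  - move=> _.
    by case: f' h0 h1 {h2} => [/(_ erefl) -> _|f' _ /(_ isT)];
      case: uF b; case: xF => //= _; nia.
  - by case: uF b; case: xF => //= _; nia.
(* The cover and the later queries cost at most [2 * #|F :\: Q|]. Since [F :\: Q] is nonempty,
   [g.+2 * #|F :\: Q|] also absorbs [a <= g]. *)
have [|T hT] := cover_phase (P := P) Dv no_known'.
  by move=> i j wp; apply/negP => iP; apply: noP; exists i, j.
exists T => w vw; have [cs hs] := hT w vw; split=> // F fF.
have [c [m [-> hc hm he]]] := hs F fF.
have fpos := Fpos w F vw fF.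
move: #|F :\: Q| #|_ :\: Q| hc hm he fpos => f e hc hm he fpos.
by split=> [|_|]; nia.
Qed.

End Strategies.

(** * The algorithm for the minimum problem with an integer parameter *)

Lemma opt_attained (R : realType) (n : nat) (D : public_data R n) w :
  in_intervals D w ->
  exists2 F, feasible Minimum D w F & (#|F| <= opt Minimum D w)%N.
Proof.
move=> Dw; rewrite /opt.
apply: (big_ind (fun m => exists2 F, feasible Minimum D w F & (#|F| <= m)%N)).
- by exists finset.setT; [exact: feasibleT|rewrite cardsT card_ord].
- move=> x y [F fF Fx] [G fG Gy].
  by have [xy|yx] := leqP x y; [exists F|exists G].
- by move=> F /asboolP fF; exists F.
Qed.

Lemma minimum_strategy (R : realType) (g n : nat) (D : public_data R n) :
  exists T : strategy R n, forall w, is_instance D w ->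
    [/\ feasible Minimum D w [set i in queries T w],
      (size (queries T w) <= g.+2 * opt Minimum D w)%N &
      (g.+1 * size (queries T w) <=
        g.+2 * (opt Minimum D w + k_M Minimum D w))%N].
Proof.
have [Dp|nDp] := pselect (in_intervals D (predicted D)); last first.
  by exists (Stop R n) => w [].
(* Before any query all assignments in the intervals agree, so the predictions can serve as the
   reference assignment. *)
have [T hT] := block_phase (mandatory Minimum D (predicted D)) finset.set0 (leq0n g) Dp.
exists T => w [Dw _]; have [|[_ _ fT] hs] := hT w.
  by split=> // i; rewrite inE.
have [F fF Fopt] := opt_attained Dw.
have [h0 h1 h2] := hs F fF.
move: h0 h1 h2; rewrite !finset.setD0 !addn0 => h0 h1 h2; split.
- by rewrite finset.set0U in fT.
- have [/h0 -> //|/h1 le] := posnP #|F|.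
  by apply: leq_trans le _; rewrite leq_mul2l Fopt orbT.
- by apply: leq_trans h2 _; rewrite leq_mul2l leq_add2r Fopt orbT.
Qed.

(** * Sorting as a minimum problem on pairs *)

Section SortingByPairs.
Variables (R : realType) (n : nat) (D : public_data R n).
Implicit Types (w : 'I_n -> R) (Q : {set 'I_n}).

Definition pairs_data : public_data R n :=
  PublicData (unc_itv D) (predicted D)
    [set [set p.1; p.2] | p : 'I_n * 'I_n &
      [exists S in family D, (p.1 \in S) && (p.2 \in S)]].

(** Positions in an ordering name the smaller element of each pair. Conversely, the comparisons that
    hold for all agreeing assignments are total on [S], and sorting by them gives one order valid
    for all. *)
Lemma sorting_pairs w Q :
  feasible Sorting D w Q <-> feasible Minimum pairs_data w Q.
Proof.
split=> [fQ S /imsetP[[a b]]|fQ S SF].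
  rewrite inE /= => /exists_inP[S0 S0F /andP[aS0 bS0]] -> _.
  have [s hs] := fQ S0 S0F.
  have min_of x y : x \in S0 -> y \in S0 -> (index x s <= index y s)%N ->
      forall v, agreeing D w Q v -> v x <= v y.
    move=> xS yS le v wv; have [ps ss] := hs v wv.
    apply: (sorted_leq_index (leT := fun i j => v i <= v j)) le => //.
    - by move=> i j k; exact: le_trans.
    - by rewrite (perm_mem ps) mem_enum.
    - by rewrite (perm_mem ps) mem_enum.
  have [le|/ltnW le] := leqP (index a s) (index b s).
    exists a => v wv; split=> [|j]; first by rewrite !inE eqxx.
    by rewrite !inE => /orP[/eqP -> //|/eqP ->]; exact: min_of wv.
  exists b => v wv; split=> [|j]; first by rewrite !inE eqxx orbT.
  by rewrite !inE => /orP[/eqP ->|/eqP -> //]; exact: min_of wv.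
pose r i j := `[< forall v, agreeing D w Q v -> v i <= v j >].
have r_total : {in S &, total r}.
  move=> i j iS jS; have := fQ [set i; j].
  have ijF : [set i; j] \in family pairs_data.
    apply/imsetP; exists (i, j) => //; rewrite inE /=.
    by apply/exists_inP; exists S => //; rewrite iS.
  have ij0 : [set i; j] != finset.set0.
    by apply/set0Pn; exists i; rewrite !inE eqxx.
  move=> /(_ ijF ij0) [k hk].
  (* [w] is not assumed to lie in the intervals; if no assignment agrees with it, every comparison
     holds vacuously. *)
  have [[v0 wv0]|no] := pselect (exists v, agreeing D w Q v); last first.
    by apply/orP; left; apply/asboolP => v wv; case: no; exists v.
  have := (hk v0 wv0).1; rewrite !inE => /orP[/eqP ek|/eqP ek]; apply/orP.
    left; apply/asboolP => v wv; rewrite -ek; apply: (hk v wv).2.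
    by rewrite !inE eqxx orbT.
  right; apply/asboolP => v wv; rewrite -ek; apply: (hk v wv).2.
  by rewrite !inE eqxx.
exists (sort r (enum S)) => v wv; split; first by rewrite perm_sort.
apply: (@sub_sorted _ r); first by move=> i j /asboolP; exact.
apply: (sort_sorted_in (P := mem S)); first exact: r_total.
by apply/allP => i; rewrite mem_enum.
Qed.

Lemma opt_pairs w : opt Sorting D w = opt Minimum pairs_data w.
Proof.
by apply: eq_bigl => Q; apply/asboolP/asboolP => /sorting_pairs.
Qed.

Lemma mandatory_pairs w :
  mandatory Sorting D w = mandatory Minimum pairs_data w.
Proof.
apply/setP => i; rewrite !inE.
by apply/asboolP/asboolP => h Q /sorting_pairs; exact: h.
Qed.

End SortingByPairs.

Lemma strategy_exists (R : realType) (pb : problem) (g n : nat)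
    (D : public_data R n) :
  exists T : strategy R n, forall w, is_instance D w ->
    [/\ feasible pb D w [set i in queries T w],
      (size (queries T w) <= g.+2 * opt pb D w)%N &
      (g.+1 * size (queries T w) <= g.+2 * (opt pb D w + k_M pb D w))%N].
Proof.
case: pb; first exact: minimum_strategy.
have [T hT] := minimum_strategy g (pairs_data D); exists T => w Dw.
rewrite opt_pairs /k_M !mandatory_pairs.
by have [fT h1 h2] := hT w Dw; split=> //; apply/sorting_pairs.
Qed.

(** * Real parameters by mixing two integer ones *)

(** [h + 2] stands for the floor of [gamma] and [t] for its fractional part. Clearing denominators
    leaves [t * (h + 1) ^+ 2 + h * t ^+ 2 + t ^+ 3], a sum of nonnegative terms. *)
Lemma mixed_ratio_le (R : realType) (h t : R) : 0 <= h -> 0 <= t <= 1 ->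
  (1 - t) * ((h + 2) / (h + 1)) + t * ((h + 3) / (h + 2)) <=
  1 + 1 / (h + 1 + t) + t / (h + 1 + t) ^+ 2.
Proof.
move=> h0 /andP[t0 t1].
have e1 : (1 - t) * ((h + 2) / (h + 1)) + t * ((h + 3) / (h + 2)) =
    1 + (h + 2 - t) / ((h + 1) * (h + 2)) by field; apply/andP; split; lra.
have e2 : 1 + 1 / (h + 1 + t) + t / (h + 1 + t) ^+ 2 =
    1 + (h + 1 + 2 * t) / (h + 1 + t) ^+ 2 by field; lra.
rewrite e1 e2 lerD2l ler_pdivrMr; last by apply: mulr_gt0; lra.
rewrite mulrAC ler_pdivlMr; last by apply: exprn_gt0; lra.
rewrite -subr_ge0.
have -> : (h + 1 + 2 * t) * ((h + 1) * (h + 2)) - (h + 2 - t) * (h + 1 + t) ^+ 2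
  = t * (h + 1) ^+ 2 + h * t ^+ 2 + t ^+ 3 by ring.
by rewrite !addr_ge0 // ?mulr_ge0 ?exprn_ge0 //; lra.
Qed.

Theorem theorem15 (R : realType) (gamma : R) (hgamma : 2 <= gamma) :
  exists xi : R,
    [/\ xi <= (gamma - (Num.floor gamma)%:~R) / (gamma - 1) ^+ 2,
        (gamma - (Num.floor gamma)%:~R) / (gamma - 1) ^+ 2 <= 1
      & forall pb : problem,
        exists A : randomized_algorithm R,
          solves pb A /\
          forall (n : nat) (D : public_data R n) (w : 'I_n -> R),
            is_instance D w ->
            (expected_queries A D w <=
             (Num.min ((1 + 1 / (gamma - 1) + xi) *
                       (1 + (k_M pb D w)%:R / (opt pb D w)%:R)) gamma *
              (opt pb D w)%:R)%:E)%E].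
Proof.
have [g eg] : exists g : nat, Num.floor gamma = g.+2%:Z.
  have : (2%:Z <= Num.floor gamma)%R by rewrite floor_ge_int.
  by case: (Num.floor gamma) => // [[|[|g]]] // _; exists g.
rewrite eg; set t := gamma - _.
have eG : gamma = g%:R + 1 + 1 + t by rewrite /t -pmulrn !mulrSr; ring.
have [t0 t1] : 0 <= t /\ t < 1.
  have := floor_le_tmp gamma; have := floorD1_gt gamma.
  by rewrite intrD eg -/t /t; split; lra.
have t01 : 0 <= t <= 1 by rewrite t0 ltW.
clearbody t.
have g0 : 0 <= g%:R :> R by [].
(* [xi] takes its largest allowed value. *)
exists (t / (gamma - 1) ^+ 2); split=> //.
  rewrite ler_pdivrMr ?mul1r; last by apply: exprn_gt0; lra.
  by apply: (le_trans (ltW t1)); rewrite expr_ge1 //; lra.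
move=> pb.
(* The seed [true], of probability [t], selects the integer above the floor of [gamma]. *)
pose strat (x : bool) n (D : public_data R n) : strategy R n :=
  projT1 (cid (strategy_exists pb (if x then g.+1 else g) D)).
have stratP x n (D : public_data R n) :=
  projT2 (cid (strategy_exists pb (if x then g.+1 else g) D)).
exists (@RandomizedAlgorithm R _ bool (bernoulli_prob t) strat
  (fun _ _ _ _ => I)); split=> [x n D w Dw|n D w Dw].
  by have [] := stratP x n D w Dw.
rewrite /expected_queries unlock /=.
rewrite integral_bernoulli_prob //.
rewrite -!EFinM -EFinD lee_fin /unstable.onem.
have /= [_ r1 c1] := stratP true n D w Dw.
have /= [_ r0 c0] := stratP false n D w Dw.
move: r1 c1 r0 c0; rewrite -/(strat true n D) -/(strat false n D).
move: (size (queries (strat true n D) w)) (size (queries (strat false n D) w)).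
move=> s1 s0.
rewrite -!(ler_nat R) !natrM !natrD.
(* For [opt] zero the quotient by it is meaningless, but neither strategy makes a query and both
   sides vanish. *)
have [->|o0] := posnP (opt pb D w).
  rewrite !mulr0 => r1 _ r0 _.
  have -> : s1%:R = 0 :> R by apply/eqP; rewrite eq_le r1 ler0n.
  have -> : s0%:R = 0 :> R by apply/eqP; rewrite eq_le r0 ler0n.
  by rewrite !mulr0 addr0.
have o0R : 0 < (opt pb D w)%:R :> R by rewrite ltr0n.
rewrite !mulrSr minr_pMl ?(ltW o0R) // le_min.
move: (opt pb D w)%:R (k_M pb D w)%:R (ler0n R (k_M pb D w)) o0R => o k k0 {}o0.
move: s1%:R s0%:R => {}s1 {}s0 r1 c1 r0 c0; apply/andP; split; last first.
  (* The ratios [g + 2] and [g + 3], taken with probabilities [1 - t] and [t], have mean [gamma]. *)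
  rewrite eG; apply: (@le_trans _ _ (t * ((g%:R + 1 + 1 + 1) * o) +
    (1 - t) * ((g%:R + 1 + 1) * o))); last by nra.
  by apply: lerD; apply: ler_wpM2l => //; lra.
(* For the bound with [k_M], the factor [o] clears the quotient, and only the mean of the two
   coefficients of [o + k] has to be compared. *)
have cancel_o (A : R) : A * (1 + k / o) * o = A * (o + k) by field; lra.
rewrite cancel_o.
apply: (@le_trans _ _ (((1 - t) * ((g%:R + 2) / (g%:R + 1)) +
    t * ((g%:R + 3) / (g%:R + 2))) * (o + k))); last first.
  apply: ler_wpM2r; first by lra.
  have -> : gamma - 1 = g%:R + 1 + t by rewrite eG; ring.
  exact: mixed_ratio_le.
have mix (x0 x1 y : R) :
  ((1 - t) * x0 + t * x1) * y = t * (x1 * y) + (1 - t) * (x0 * y) by ring.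
rewrite mix; apply: lerD; apply: ler_wpM2l; rewrite ?subr_ge0 ?(ltW t1) //.
  by rewrite mulrAC ler_pdivlMr; lra.
by rewrite mulrAC ler_pdivlMr; lra.
Qed.
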